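(* Let $K\ge1$ be an integer and $\rho>0$. Then $$2\,\widetilde\pi_K(K-1,K)=\frac{2\rho^{2K-1}}{2\sum_{k=0}^{2K-1}\rho^k-\sum_{k=0}^{K-1}(\rho/2)^k},$$ and, if $\rho\neq 1,2$, this is also equal to $$\frac{(1-\rho)(2-\rho)}{\rho^{-(2K-1)}+\rho(1-\rho)(2\rho)^{-K}-\rho(2-\rho)}.$$
   Context: Variant of the join-the-shortest-queue model with two queues of capacity $K$ in which the system cannot contain more than $2K-1$ customers in total. It is the continuous-time Markov chain on $\{0,\dots,K\}^2\setminus\{(K,K)\}$ with the following transition rates. From $(k,k)$, $0\le k\le K-1$: to $(k+1,k)$ and to $(k,k+1)$ at rate $\rho$ each; to $(k-1,k)$ and to $(k,k-1)$ at rate $1$ each if $k>0$. From $(j,k)$ with $0\le j<k\le K$: to $(j+1,k)$ at rate $2\rho$ if $(j,k)\ne(K-1,K)$, to $(j-1,k)$ at rate $1$ if $j>0$, to $(j,k-1)$ at rate $1$. From $(k,j)$ with $0\le j<k\le K$: to $(k,j+1)$ at rate $2\rho$ if $(k,j)\ne(K,K-1)$, to $(k,j-1)$ at rate $1$ if $j>0$, to $(k-1,j)$ at rate $1$. (There are no transitions to or from $(K,K)$.) $\widetilde\pi_K$ denotes its unique invariant probability distribution; the stationary blocking probability is $\widetilde\pi_K(K-1,K)+\widetilde\pi_K(K,K-1)=2\widetilde\pi_K(K-1,K)$. *)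

(* Defs.v *)
From mathcomp Require Import all_boot all_order all_algebra.
Set Implicit Arguments.
Unset Strict Implicit.
Unset Printing Implicit Defensive.
Import Order.TTheory GRing.Theory Num.Theory.
Local Open Scope ring_scope.

(* Generator of the continuous-time Markov chain on T with jump rates q x y,
   x != y (the values q x x are ignored). *)
Definition generator (R : realFieldType) (T : finType) (q : T -> T -> R)
    (x y : T) : R :=
  if y == x then - (\sum_(z : T | z != x) q x z) else q x y.

Definition invariant_distribution (R : realFieldType) (T : finType)
    (q : T -> T -> R) (pi : T -> R) : Prop :=
  [/\ forall x : T, 0 <= pi x,
      \sum_(x : T) pi x = 1
    & forall y : T, \sum_(x : T) pi x * generator q x y = 0].

Definition jsq_state (K : nat) : Type :=
  {x : 'I_K.+1 * 'I_K.+1 | x != (ord_max, ord_max)}.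

Definition jsq_lengths (K : nat) (x : jsq_state K) : nat * nat :=
  ((val x).1 : nat, (val x).2 : nat).

(* On the diagonal no capacity test is needed: there a < K in jsq_state K. *)
Definition jsq_rate (R : realFieldType) (K : nat) (rho : R)
    (x y : jsq_state K) : R :=
  let: (a, b) := jsq_lengths x in
  let: z := jsq_lengths y in
  if a == b then
    if (z == (a.+1, b)) || (z == (a, b.+1)) then rho
    else if (0 < a)%N && ((z == (a.-1, b)) || (z == (a, b.-1))) then 1
    else 0
  else if (a < b)%N then
    if (z == (a.+1, b)) && ((a, b) != (K.-1, K)) then 2 * rho
    else if ((0 < a)%N && (z == (a.-1, b))) || (z == (a, b.-1)) then 1
    else 0
  else
    if (z == (a, b.+1)) && ((a, b) != (K, K.-1)) then 2 * rho
    else if ((0 < b)%N && (z == (a, b.-1))) || (z == (a.-1, b)) then 1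
    else 0.

Lemma jsq_blocked_subproof (K : nat) (hK : (1 <= K)%N) :
  (inord K.-1, ord_max) != (ord_max, ord_max) :> 'I_K.+1 * 'I_K.+1.
Proof.
apply/eqP => -[] /(congr1 val) /=; rewrite inordK; last by case: K hK.
by case: K hK => // K _ /= /n_Sn.
Qed.

Definition jsq_blocked (K : nat) (hK : (1 <= K)%N) : jsq_state K :=
  Sub (inord K.-1, ord_max) (jsq_blocked_subproof hK).

Lemma jsq_blockedE (K : nat) (hK : (1 <= K)%N) :
  jsq_lengths (jsq_blocked hK) = (K.-1, K).
Proof. by rewrite /jsq_lengths /= inordK //; case: K hK. Qed.

Lemma generator_row_sum (R : realFieldType) (T : finType) (q : T -> T -> R) x :
  \sum_y generator q x y = 0.
Proof.
rewrite (bigD1 x) //= {1}/generator eqxx addrC; apply/eqP; rewrite subr_eq0.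
by apply/eqP/eq_bigr => y /negbTE yx; rewrite /generator yx.
Qed.

Lemma generator_abs (R : realFieldType) (T : finType) (q : T -> T -> R)
    (v : T -> R) :
  (forall x y, 0 <= q x y) ->
  (forall y, \sum_x v x * generator q x y = 0) ->
  forall y, \sum_x `|v x| * generator q x y = 0.
Proof.
move=> q0 vG y.
have s0 z : true -> 0 <= \sum_x `|v x| * generator q x z.
  move=> _; rewrite (bigD1 z) //= addrC.
  have gz : generator q z z <= 0.
    by rewrite /generator eqxx oppr_le0 sumr_ge0.
  have -> : `|v z| * generator q z z = - `|v z * generator q z z|.
    by rewrite normrM (ler0_norm gz) mulrN opprK.
  rewrite subr_ge0.
  have := vG z; rewrite (bigD1 z) //= => /eqP; rewrite addr_eq0 => /eqP ->.
  rewrite normrN; apply: le_trans (ler_norm_sum _ _ _) _.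
  apply: ler_sum => x xz; rewrite normrM ler_wpM2l //.
  by rewrite /generator eq_sym (negbTE xz) ger0_norm.
apply: (psumr_eq0P s0) => //; rewrite exchange_big /= big1 // => x _.
by rewrite -mulr_sumr generator_row_sum mulr0.
Qed.

Lemma invariant_distribution_exists (R : realFieldType) (T : finType)
    (q : T -> T -> R) (x0 : T) :
  (forall x y, 0 <= q x y) -> exists pi, invariant_distribution q pi.
Proof.
move=> q0.
pose G := \matrix_(i < #|T|, j < #|T|) generator q (enum_val i) (enum_val j).
have : \det G == 0.
  rewrite -det_tr; apply/det0P; exists (const_mx 1).
    apply/eqP => /rowP /(_ (enum_rank x0)) /eqP.
    by rewrite !mxE oner_eq0.
  apply/rowP => i; rewrite !mxE.
  under eq_bigr do rewrite !mxE mul1r.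
  rewrite -[RHS](generator_row_sum q (enum_val i)).
  by rewrite [RHS](reindex _ (onW_bij _ (@enum_val_bij T))).
case/det0P => w w0 wG; pose v x := w 0 (enum_rank x).
have vG y : \sum_x v x * generator q x y = 0.
  have /rowP/(_ (enum_rank y)) := wG; rewrite !mxE; apply: etrans.
  rewrite [LHS](reindex _ (onW_bij _ (@enum_val_bij T))) /=.
  by apply: eq_bigr => i _; rewrite /v mxE enum_valK enum_rankK.
have aG := generator_abs q0 vG.
have S0 : 0 <= \sum_x `|v x| by apply: sumr_ge0.
have Sn : \sum_x `|v x| != 0.
  apply: contraNneq w0 => /psumr_eq0P v0; apply/eqP/rowP => i.
  have /eqP := v0 (fun _ _ => normr_ge0 _) (enum_val i) isT.
  by rewrite normr_eq0 /v enum_valK mxE => /eqP.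
exists (fun x => `|v x| / \sum_x `|v x|); split.
- by move=> x; rewrite divr_ge0.
- by rewrite -mulr_suml divff.
- move=> y; under eq_bigr do rewrite mulrAC.
  by rewrite -mulr_suml aG mul0r.
Qed.


Lemma invariant_vanish (R : realFieldType) (T : finType) (q : T -> T -> R)
    (m : T -> nat) (x0 : T) (w : T -> R) :
  (forall x y, 0 <= q x y) ->
  (forall x, x != x0 -> exists2 y, (m y < m x)%N & 0 < q x y) ->
  (forall x, 0 <= w x) ->
  (forall y, \sum_x w x * generator q x y = 0) ->
  w x0 = 0 -> forall x, w x = 0.
Proof.
move=> q0 down w0 wG wx0 x; have [n] := ubnP (m x).
elim: n x => // n IHn x mx; have [-> //|/down[y myx qxy]] := eqVneq x x0.
have wy : w y = 0 by apply: IHn; apply: leq_trans myx _.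
have xy : x != y by apply: contraTneq myx => ->; rewrite ltnn.
have := wG y; rewrite (bigD1 y) //= wy mul0r add0r => /psumr_eq0P S.
have /eqP : w x * generator q x y = 0.
  apply: S => // z zy; rewrite mulr_ge0 //.
  by rewrite /generator eq_sym (negbTE zy).
rewrite mulf_eq0 /generator [y == x]eq_sym (negbTE xy) (gt_eqF qxy) orbF.
by move/eqP.
Qed.

Lemma invariant_distribution_unique (R : realFieldType) (T : finType)
    (q : T -> T -> R) (m : T -> nat) (x0 : T) (p1 p2 : T -> R) :
  (forall x y, 0 <= q x y) ->
  (forall x, x != x0 -> exists2 y, (m y < m x)%N & 0 < q x y) ->
  invariant_distribution q p1 -> invariant_distribution q p2 -> p1 =1 p2.
Proof.
move=> q0 down.
wlog le0 : p1 p2 / p1 x0 <= p2 x0.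
  by move=> H I1 I2; case: (leP (p1 x0) (p2 x0)) => [|/ltW] le0 x;
    [apply: H | apply/esym/H].
move=> [_ s1 G1] [_ s2 G2] x; pose v z := p2 z - p1 z.
have vG y : \sum_z v z * generator q z y = 0.
  by under eq_bigr do rewrite mulrBl; rewrite sumrB G1 G2 subrr.
have aG := generator_abs q0 vG.
have vabs z : `|v z| - v z = 0.
  apply: (invariant_vanish (w := fun z => `|v z| - v z) q0 down) => //.
  - by move=> t; rewrite subr_ge0 ler_norm.
  - move=> y; under eq_bigr do rewrite mulrBl.
    by rewrite sumrB aG vG subrr.
  - by apply/eqP; rewrite subr_eq0 ger0_norm // subr_ge0.
have v0 z : true -> 0 <= v z by rewrite -(subr0_eq (vabs z)).
have /(psumr_eq0P v0)/(_ x isT)/subr0_eq-> // : \sum_z v z = 0.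
by rewrite sumrB s1 s2 subrr.
Qed.

Lemma jsq_invariant_distribution_exists_unique (R : realFieldType) (K : nat)
    (rho : R) (hK : (1 <= K)%N) (hrho : 0 < rho) :
  exists pi : jsq_state K -> R,
    invariant_distribution (jsq_rate rho) pi /\
    forall pi' : jsq_state K -> R,
      invariant_distribution (jsq_rate rho) pi' -> pi' =1 pi.
Proof.
have q0 x y : 0 <= jsq_rate (K := K) rho x y.
  have r0 := ltW hrho; have r20 : 0 <= 2 * rho by rewrite mulr_ge0.
  by rewrite /jsq_rate /jsq_lengths; repeat case: ifP => // _.
have z0 : (ord0, ord0) != (ord_max, ord_max) :> 'I_K.+1 * 'I_K.+1.
  by apply/eqP => -[] E; rewrite -E in hK.
pose x0 : jsq_state K := Sub (ord0, ord0) z0.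
pose m (x : jsq_state K) := ((jsq_lengths x).1 + (jsq_lengths x).2)%N.
have down x : x != x0 -> exists2 y, (m y < m x)%N & 0 < jsq_rate rho x y.
  case: x => [[a b] abK] xx0; have [ab|ba] := leqP a b.
    have b0 : (0 < b)%N.
      move: xx0 ab; rewrite -val_eqE /= xpair_eqE -!val_eqE /= lt0n.
      by case: (nat_of_ord b) => //; rewrite leqn0 andbT => /negbTE->.
    have bK : (b.-1 < K.+1)%N by rewrite prednK // ltnW.
    have yK : (a, Ordinal bK) != (ord_max, ord_max).
      apply: contraTneq b0 => -[] _ E.
      by have := ltn_ord b; case: (nat_of_ord b) E => //= n ->; rewrite ltnn.
    exists (Sub (a, Ordinal bK) yK).
      by rewrite /m /= ltn_add2l prednK.
    rewrite /jsq_rate /= !xpair_eqE !eqxx (ltn_eqF (ltnSn a)) (ltn_eqF (leq_ltn_trans (leq_pred b) (ltnSn b))) !andbF !orbT /=.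
    have [E|ne] := eqVneq (nat_of_ord a) b; first by rewrite E b0.
    by rewrite ltn_neqAle ne ab.
  have a0 : (0 < a)%N by apply: leq_ltn_trans ba.
  have aK : (a.-1 < K.+1)%N by rewrite prednK // ltnW.
  have yK : (Ordinal aK, b) != (ord_max, ord_max).
    apply: contraTneq a0 => -[] E _.
    by have := ltn_ord a; case: (nat_of_ord a) E => //= n ->; rewrite ltnn.
  exists (Sub (Ordinal aK, b) yK).
    by rewrite /m /= ltn_add2r prednK.
  rewrite /jsq_rate /= !xpair_eqE !eqxx (gtn_eqF ba) ltnNge (ltnW ba) /=.
  rewrite (ltn_eqF (ltnSn b)) andbF !orbT.
  by rewrite ltr01.
have [pi pi_inv] := invariant_distribution_exists x0 q0.
exists pi; split=> // pi' pi'_inv.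
exact: (invariant_distribution_unique q0 down).
Qed.

(* Main.v *)
Require Import Defs.
From mathcomp Require Import all_boot all_order all_algebra.
From mathcomp Require Import zify ring.
(* A test function solving a Poisson equation: write q = 1 / rho and let h(i, n)
   be the function [hit] below, where i is the length of the shorter queue and
   n the total number of customers. In the join-the-shortest-queue model without
   any capacity the generator maps h to the constant 2 rho. In the capped chain
   the only difference is the missing jump from the blocked states to (K, K),
   hence integrating against the invariant distribution gives
   1 = (blocking probability) * (h(K, 2K) - h(K-1, 2K-1)),
   and the last factor is the explicit sum
   sum_(j < 2K) q^j - q^(2K-1) / 2 * sum_(j < K) (rho / 2)^j. *)

Set Implicit Arguments.
Unset Strict Implicit.
Unset Printing Implicit Defensive.
Import Order.TTheory GRing.Theory Num.Theory.
Local Open Scope ring_scope.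

(** * The test function [hit] and its drift without capacity *)

Definition geo (R : fieldType) (q : R) (n : nat) : R := \sum_(j < n) q ^+ j.

(* The truncated subtraction is harmless where [hit] is used: there
   [i.*2 <= n.+1], so [j.*2.+1 <= n] for all [j < i]. *)
Definition hit (R : fieldType) (q : R) (i n : nat) : R :=
  \sum_(m < n.+1) geo q m
  - q / 2 * \sum_(j < i) (q / 2) ^+ j * geo q (n - j.*2.+1).

Lemma geo0 (R : fieldType) (q : R) : geo q 0 = 0.
Proof. by rewrite /geo big_ord0. Qed.

Lemma geoS (R : fieldType) (q : R) n : geo q n.+1 = 1 + q * geo q n.
Proof.
rewrite /geo big_ord_recl expr0 mulr_sumr; congr (_ + _).
by apply: eq_bigr => j _; rewrite exprS.
Qed.

Lemma hitSl (R : fieldType) (q : R) i n :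
  hit q i.+1 n = hit q i n - q / 2 * ((q / 2) ^+ i * geo q (n - i.*2.+1)).
Proof. by rewrite /hit [X in _ - _ * X]big_ord_recr /=; ring. Qed.

Lemma hitSr (R : fieldType) (q : R) i n : (i.*2 <= n.+1)%N ->
  hit q i n.+1 = hit q i n + geo q n.+1
    - q / 2 * \sum_(j < i) (q / 2) ^+ j * q ^+ (n - j.*2.+1).
Proof.
move=> in1; rewrite /hit big_ord_recr /=.
have -> : \sum_(j < i) (q / 2) ^+ j * geo q (n.+1 - j.*2.+1) =
    \sum_(j < i) (q / 2) ^+ j * geo q (n - j.*2.+1)
    + \sum_(j < i) (q / 2) ^+ j * q ^+ (n - j.*2.+1).
  rewrite -big_split /=; apply: eq_bigr => j _; rewrite -mulrDr.
  have -> : (n.+1 - j.*2.+1 = (n - j.*2.+1).+1)%N.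
    by have := ltn_ord j; lia.
  by rewrite /geo big_ord_recr.
by ring.
Qed.

(** At [q = rho^-1] this scaling makes the correction sums cancel in the drift: arrivals, of total
    rate [2 * rho], contribute twice what a single departure of rate 1 takes back, and there are two
    departures. *)
Lemma hit_incrS (R : fieldType) (q : R) i n : (i.*2 <= n.+1)%N ->
  \sum_(j < i) (q / 2) ^+ j * q ^+ (n.+1 - j.*2.+1) =
  q * \sum_(j < i) (q / 2) ^+ j * q ^+ (n - j.*2.+1).
Proof.
move=> in1; rewrite mulr_sumr; apply: eq_bigr => j _.
have -> : (n.+1 - j.*2.+1 = (n - j.*2.+1).+1)%N.
    by have := ltn_ord j; lia.
by rewrite exprS mulrCA.
Qed.

Lemma hit_drift_empty (R : fieldType) (rho : R) : rho != 0 ->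
  2 * rho * (hit rho^-1 0 1 - hit rho^-1 0 0) = 2 * rho.
Proof. by move=> r0; rewrite hitSr // big_ord0 /geo big_ord1 expr0; ring. Qed.

(** The empty queue has no departure. The [j = 0] correction that an arrival there brings in,
    weighted by [2 * rho], is [- geo rho^-1 k.+1], exactly what the missing departure would have
    contributed. *)
Lemma hit_drift_idle (R : realFieldType) (rho : R) k : rho != 0 ->
  2 * rho * (hit rho^-1 1 k.+2 - hit rho^-1 0 k.+1)
  + (hit rho^-1 0 k - hit rho^-1 0 k.+1) = 2 * rho.
Proof.
move=> r0; rewrite hitSl !hitSr // !big_ord0 expr0 subSS subn0 (geoS _ k.+1).
by field; rewrite ?r0.
Qed.

Lemma hit_drift_diag (R : realFieldType) (rho : R) i : rho != 0 ->
  2 * rho * (hit rho^-1 i.+1 i.*2.+3 - hit rho^-1 i.+1 i.*2.+2)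
  + 2 * (hit rho^-1 i i.*2.+1 - hit rho^-1 i.+1 i.*2.+2) = 2 * rho.
Proof.
move=> r0; rewrite (@hitSr _ _ i.+1 i.*2.+2); last lia.
rewrite (@hitSr _ _ i.+1 i.*2.+1); last lia.
rewrite (@hit_incrS _ _ i.+1 i.*2.+1); last lia.
(* A departure from the diagonal shortens the shorter queue at no extra cost: the correction dropped
   is a multiple of [geo q 0 = 0]. *)
rewrite (hitSl _ i i.*2.+1) subnn geo0 (geoS _ i.*2.+2).
by field; rewrite ?r0.
Qed.

Lemma hit_drift_off (R : realFieldType) (rho : R) i n : rho != 0 ->
    (i.+1.*2 <= n.+1)%N ->
  2 * rho * (hit rho^-1 i.+2 n.+2 - hit rho^-1 i.+1 n.+1)
  + (hit rho^-1 i n - hit rho^-1 i.+1 n.+1)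
  + (hit rho^-1 i.+1 n - hit rho^-1 i.+1 n.+1) = 2 * rho.
Proof.
move=> r0 in1; rewrite (hitSl _ i.+1 n.+2).
rewrite (@hitSr _ _ i.+1 n.+1); last lia.
rewrite (@hitSr _ _ i.+1 n) // hit_incrS // (hitSl _ i n).
(* The correction gained when the shorter queue grows and the one lost when it shrinks involve the
   same [geo]; the rates [2 * rho] and 1 make them cancel. *)
have -> : (n.+2 - i.+1.*2.+1 = n - i.*2.+1)%N by lia.
rewrite (geoS _ n.+1) exprS.
by field; rewrite ?r0.
Qed.

Lemma hit_jump (R : realFieldType) (rho : R) k : rho != 0 ->
  hit rho^-1 k.+1 k.*2.+2 - hit rho^-1 k k.*2.+1 =
  geo rho^-1 k.*2.+2 - rho^-1 ^+ k.*2.+1 / 2 * \sum_(j < k.+1) (rho / 2) ^+ j.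
Proof.
move=> r0; rewrite (@hitSr _ _ k.+1 k.*2.+1); last lia.
rewrite (hitSl _ k) subnn geo0.
have -> : \sum_(j < k.+1) (rho^-1 / 2) ^+ j * rho^-1 ^+ (k.*2.+1 - j.*2.+1) =
    rho^-1 ^+ k.*2 * \sum_(j < k.+1) (rho / 2) ^+ j.
  rewrite mulr_sumr; apply: eq_bigr => j _.
  (* One of the two factors [rho^-1 ^+ j] absorbs [rho ^+ j], turning [rho / 2] into
     [rho^-1 / 2]. *)
  have -> : rho^-1 ^+ k.*2 =
      rho^-1 ^+ j * rho^-1 ^+ j * rho^-1 ^+ (k.*2 - j.*2).
    by rewrite -!exprD; congr (_ ^+ _); have := ltn_ord j; lia.
  have rK : rho^-1 ^+ j * rho ^+ j = 1 by rewrite -exprMn mulVf ?expr1n.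
  rewrite subSS !exprMn -[LHS]mul1r -rK; ring.
by rewrite exprS; ring.
Qed.

(** * Stationary averages and exchange of the two queues *)

Lemma invariant_drift (R : realFieldType) (T : finType) (q : T -> T -> R)
    (pi F : T -> R) :
  invariant_distribution q pi ->
  \sum_x pi x * \sum_y q x y * (F y - F x) = 0.
Proof.
case=> _ _ piG.
(* The terms [- F x] supply the diagonal of the generator, while the ignored rate [q x x] is
   multiplied by zero. *)
have dE x : \sum_y q x y * (F y - F x) = \sum_y generator q x y * F y.
  rewrite (bigD1 x) //= subrr mulr0 add0r [RHS](bigD1 x) //= {1}/generator eqxx.
  rewrite mulNr mulr_suml -sumrN -big_split /=; apply: eq_bigr => y yx.
  by rewrite /generator (negbTE yx); ring.
under eq_bigr do rewrite dE mulr_sumr; rewrite exchange_big /= big1 // => y _.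
by under eq_bigr do rewrite mulrA; rewrite -mulr_suml piG mul0r.
Qed.

Lemma jsq_swap_subproof K (x : jsq_state K) :
  ((val x).2, (val x).1) != (ord_max, ord_max).
Proof. by case: x => -[a b] abK; rewrite /= xpair_eqE andbC -xpair_eqE. Qed.

Definition jsq_swap K (x : jsq_state K) : jsq_state K :=
  Sub ((val x).2, (val x).1) (jsq_swap_subproof x).

Lemma jsq_swapK K : involutive (@jsq_swap K).
Proof. by move=> x; apply: val_inj; rewrite /=; case: (val x). Qed.

Lemma jsq_rate_swap (R : realFieldType) K (rho : R) (x y : jsq_state K) :
  jsq_rate rho (jsq_swap x) (jsq_swap y) = jsq_rate rho x y.
Proof.
rewrite /jsq_rate /jsq_lengths; case: x y => -[a b] _ [] [c d] _ /=.
have sw (m n m' n' : nat) : ((m, n) == (m', n')) = ((n, m) == (n', m')).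
  by rewrite !xpair_eqE andbC.
rewrite !(sw d c) !(sw b a).
case: (ltngtP a b) => [ab|ba|ab] //=.
by rewrite ab orbC [X in (0 < _)%N && X]orbC.
Qed.

(** The image of [pi] under the exchange of the queues is again invariant, because the rates are
    symmetric; uniqueness then identifies it with [pi]. *)
Lemma jsq_invariant_swap (R : realFieldType) K (rho : R)
    (pi : jsq_state K -> R) :
  (1 <= K)%N -> 0 < rho -> invariant_distribution (jsq_rate rho) pi ->
  forall x, pi (jsq_swap x) = pi x.
Proof.
move=> hK r0 hpi x.
have [p [_ pu]] := jsq_invariant_distribution_exists_unique hK r0.
have swB := onW_bij predT (inv_bij (@jsq_swapK K)).
suff: invariant_distribution (jsq_rate rho) (fun x => pi (jsq_swap x)).
  by move/pu => ->; rewrite pu.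
have [p0 p1 pG] := hpi; split=> [z||z]; first exact: p0.
  by rewrite -p1 [RHS](reindex _ swB).
rewrite -[RHS](pG (jsq_swap z)) [RHS](reindex _ swB) /=; apply: eq_bigr => t _.
congr (_ * _); rewrite /generator (inj_eq (inv_inj (@jsq_swapK K))).
rewrite jsq_rate_swap; case: eqP => // _; congr (- _).
rewrite [RHS](reindex_inj (inv_inj (@jsq_swapK K))) /=; apply: eq_big => s.
  by rewrite (inj_eq (inv_inj (@jsq_swapK K))).
by rewrite jsq_rate_swap.
Qed.

(** * The drift of the test function in the capped chain *)

Lemma sum_jsq_pick (R : realFieldType) K (g : nat * nat -> R) (a b : nat) :
  (a <= K)%N -> (b <= K)%N -> (a, b) != (K, K) ->
  \sum_(y : jsq_state K) (jsq_lengths y == (a, b))%:R * g (jsq_lengths y)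
  = g (a, b).
Proof.
move=> aK bK abK.
have zP : (inord a, inord b) != (ord_max, ord_max) :> 'I_K.+1 * 'I_K.+1.
  apply: contraNneq abK => -[/(congr1 val) /= + /(congr1 val) /=].
  by rewrite !inordK // => -> ->.
have zE : jsq_lengths (Sub (inord a, inord b) zP : jsq_state K) = (a, b).
  by rewrite /jsq_lengths /= !inordK.
rewrite (bigD1 (Sub (inord a, inord b) zP)) //= zE eqxx mul1r big1 ?addr0 //.
move=> y; case: (jsq_lengths y =P _) => [yE|_ _]; last by rewrite mul0r.
case/eqP; apply: val_inj => /=.
case: y yE => -[c d] cdK [<- <-] /=.
by rewrite !inord_val.
Qed.

Lemma jsq_drift_diag (R : realFieldType) K (rho : R) (x : jsq_state K)
    (g : nat * nat -> R) a :
  jsq_lengths x = (a, a) ->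
  \sum_y jsq_rate rho x y * (g (jsq_lengths y) - g (a, a)) =
  rho * (g (a.+1, a) - g (a, a)) + rho * (g (a, a.+1) - g (a, a))
  + (0 < a)%N%:R * (g (a.-1, a) - g (a, a))
  + (0 < a)%N%:R * (g (a, a.-1) - g (a, a)).
Proof.
move=> xE; pose G z := g z - g (a, a).
have aK : (a < K)%N.
  case: x xE => -[i j] /= + [iE jE]; rewrite xpair_eqE -!val_eqE /= iE jE andbb.
  by have := ltn_ord i; lia.
transitivity (\sum_(y : jsq_state K) (
  rho * ((jsq_lengths y == (a.+1, a))%:R * G (jsq_lengths y))
  + rho * ((jsq_lengths y == (a, a.+1))%:R * G (jsq_lengths y))
  + (0 < a)%N%:R * ((jsq_lengths y == (a.-1, a))%:R * G (jsq_lengths y))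
  + (0 < a)%N%:R * ((jsq_lengths y == (a, a.-1))%:R * G (jsq_lengths y)))).
  apply: eq_bigr => y _; rewrite /jsq_rate xE eqxx -/(G _).
  move: (G _) => u; case: (jsq_lengths y) => c d; rewrite !xpair_eqE.
  (* At most one jump condition holds for a given target, so the nested tests of [jsq_rate] equal a
     sum of indicators. The guard [0 < a] matters: for [a = 0] both departure targets collapse to
     [(0, 0)]. *)
  have : [&& ~~ ((c == a.+1) && (d == a) && ((c == a) && (d == a.+1))),
    ~~ (((c == a.+1) && (d == a) || (c == a) && (d == a.+1)) && (0 < a)%N
       && ((c == a.-1) && (d == a) || (c == a) && (d == a.-1)))
    & ~~ ((0 < a)%N && ((c == a.-1) && (d == a)) && ((c == a) && (d == a.-1)))].
    by lia.
  move: ((c == a.+1) && _) ((c == a) && (d == a.+1)) ((c == a.-1) && _)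
    ((c == a) && (d == a.-1)) (0 < a)%N => b1 b2 b3 b4 b5.
  by case: b1; case: b2; case: b5; case: b3; case: b4 => //= _; ring.
by rewrite !big_split /= -!mulr_sumr !sum_jsq_pick ?xpair_eqE //; lia.
Qed.

Lemma jsq_drift_lt (R : realFieldType) K (rho : R) (x : jsq_state K)
    (g : nat * nat -> R) a b :
  jsq_lengths x = (a, b) -> (a < b)%N ->
  \sum_y jsq_rate rho x y * (g (jsq_lengths y) - g (a, b)) =
  ((a, b) != (K.-1, K))%:R * (2 * rho * (g (a.+1, b) - g (a, b)))
  + (0 < a)%N%:R * (g (a.-1, b) - g (a, b)) + (g (a, b.-1) - g (a, b)).
Proof.
move=> xE ab; pose G z := g z - g (a, b).
have bK : (b <= K)%N by case: xE => _ <-; exact: leq_ord.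
transitivity (\sum_(y : jsq_state K) (
  ((a, b) != (K.-1, K))%:R
    * (2 * rho * ((jsq_lengths y == (a.+1, b))%:R * G (jsq_lengths y)))
  + (0 < a)%N%:R * ((jsq_lengths y == (a.-1, b))%:R * G (jsq_lengths y))
  + (jsq_lengths y == (a, b.-1))%:R * G (jsq_lengths y))).
  apply: eq_bigr => y _; rewrite /jsq_rate xE (ltn_eqF ab) ab -/(G _).
  move: (G _) ((a, b) != _) => u b0.
  case: (jsq_lengths y) => c d; rewrite !xpair_eqE.
  have : [&& ~~ ((c == a.+1) && (d == b) && ((c == a) && (d == b.-1))),
      ~~ ((c == a.+1) && (d == b) && ((c == a.-1) && (d == b)))
    & ~~ ((0 < a)%N && ((c == a.-1) && (d == b)) && ((c == a) && (d == b.-1)))].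
    by lia.
  move: ((c == a.+1) && _) ((c == a.-1) && _) ((c == a) && _) (0 < a)%N.
  move=> b1 b2 b3 b5.
  by case: b0; case: b1; case: b5; case: b2; case: b3 => //= _; ring.
rewrite !big_split /= -!mulr_sumr xpair_eqE.
rewrite (@sum_jsq_pick _ _ G a.-1) ?xpair_eqE; try lia.
rewrite (@sum_jsq_pick _ _ G a b.-1) ?xpair_eqE; try lia.
(* In the blocked state the arrival target [(K, K)] is not a state, but its coefficient is zero. *)
case: (boolP (_ && _)) => abK /=; first by rewrite !mul0r.
by rewrite sum_jsq_pick // ?xpair_eqE; lia.
Qed.

(** The function [g] lives on all pairs of lengths, so it can be evaluated at [(K, K)] although this
    is not a state; the suppressed jump there is the only deviation from the drift [2 * rho]. *)
Lemma jsq_hit_drift (R : realFieldType) K (rho : R) (x : jsq_state K) :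
  let g z : R := hit rho^-1 (minn z.1 z.2) (z.1 + z.2) in
  (1 <= K)%N -> rho != 0 ->
  \sum_y jsq_rate rho x y * (g (jsq_lengths y) - g (jsq_lengths x)) =
  2 * rho * (1 - ((jsq_lengths x == (K.-1, K))
                  || (jsq_lengths x == (K, K.-1)))%:R * (g (K, K) - g (K.-1, K))).
Proof.
move=> g hK r0.
have gC a b : g (a, b) = g (b, a) by rewrite /g /= minnC addnC.
have gE a b : (a <= b)%N -> g (a, b) = hit rho^-1 a (a + b).
  by rewrite /g /= => /minn_idPl ->.
(* Both [g] and the rates are symmetric under [jsq_swap]. *)
wlog ab : x / ((jsq_lengths x).1 <= (jsq_lengths x).2)%N => [hw|].
  have [/hw //|ba] := leqP (jsq_lengths x).1 (jsq_lengths x).2.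
  have gS y : g (jsq_lengths (jsq_swap y)) = g (jsq_lengths y) by rewrite gC.
  have := hw (jsq_swap x) (ltnW ba); rewrite gS /=.
  rewrite (reindex_inj (inv_inj (@jsq_swapK K))) /=.
  under eq_bigr do rewrite gS jsq_rate_swap.
  move=> ->; rewrite orbC /jsq_lengths !xpair_eqE /=.
  by rewrite ![((val x).2 == _ :> nat) && _]andbC.
case xE: (jsq_lengths x) ab => [a b] /= ab.
have bK : (b <= K)%N by case: xE => _ <-; exact: leq_ord.
move: ab; rewrite leq_eqVlt => /predU1P[ab|ab].
  rewrite -{b}ab in xE bK *; rewrite (jsq_drift_diag _ _ xE) !xpair_eqE.
  rewrite -(gC a a.+1) (gC a a.-1).
  have -> : (a == K.-1) && (a == K) || (a == K) && (a == K.-1) = false by lia.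
  rewrite mul0r subr0 mulr1.
  case: a xE bK => [|i] xE bK.
    rewrite !gE // addn0 add0n !mul0r -[RHS](hit_drift_empty r0); ring.
  rewrite !gE //= -[RHS](hit_drift_diag i r0).
  have -> : (i.+1 + i.+2 = i.*2.+3)%N by lia.
  have -> : (i.+1 + i.+1 = i.*2.+2)%N by lia.
  have -> : (i + i.+1 = i.*2.+1)%N by lia.
  by ring.
(* The drift with the arrival always allowed; a blocked state then only loses its first term. *)
have full : 2 * rho * (g (a.+1, b) - g (a, b))
    + (0 < a)%N%:R * (g (a.-1, b) - g (a, b)) + (g (a, b.-1) - g (a, b))
    = 2 * rho.
  case: a b ab {xE bK} => [|i] [//|k] ab.
    rewrite !gE //= mul0r addr0 add0n add1n; exact: hit_drift_idle.
  rewrite !gE //=; try lia.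
  have -> : (i.+2 + k.+1 = (i.+1 + k).+2)%N by lia.
  rewrite addnS addSnnS mul1r; apply: hit_drift_off => //; lia.
rewrite (jsq_drift_lt _ _ xE ab) [RHS]mulrBr [X in _ = X - _]mulr1 -[X in _ = X - _]full.
have -> : ((a, b) == (K, K.-1)) = false by rewrite xpair_eqE; lia.
rewrite orbF; case: eqP => [[aK ->]|_] /=; last by ring.
by rewrite -aK (_ : a.+1 = K) ?aK ?prednK //; ring.
Qed.

(** * The blocking probability and its closed forms *)

Lemma jsq_blocking_inv (R : realFieldType) K (rho : R) (hK : (1 <= K)%N)
    (pi : jsq_state K -> R) :
  0 < rho -> invariant_distribution (jsq_rate rho) pi ->
  2 * pi (jsq_blocked hK) *
    (geo rho^-1 (2 * K)
     - rho^-1 ^+ (2 * K - 1) / 2 * \sum_(j < K) (rho / 2) ^+ j) = 1.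
Proof.
move=> rho0 hpi; have r0 := lt0r_neq0 rho0.
pose g z : R := hit rho^-1 (minn z.1 z.2) (z.1 + z.2).
have := invariant_drift (fun x => g (jsq_lengths x)) hpi.
under eq_bigr do rewrite (jsq_hit_drift _ hK r0) -/g mulrCA.
(* Dividing by [2 * rho] leaves that the mean of 1 minus the blocking indicator times the jump is
   zero. *)
rewrite -mulr_sumr => /eqP; rewrite !mulf_eq0 pnatr_eq0 (negbTE r0) /= => /eqP.
set jump := g (K, K) - g (K.-1, K).
have -> : geo rho^-1 (2 * K)
     - rho^-1 ^+ (2 * K - 1) / 2 * \sum_(j < K) (rho / 2) ^+ j = jump.
  rewrite /jump /g /=; case: (K) hK => // k _; rewrite minnn (minn_idPl (leqnSn k)).
  have -> : (k.+1 + k.+1 = k.*2.+2)%N by lia.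
  have -> : (k + k.+1 = k.*2.+1)%N by lia.
  have -> : (2 * k.+1 - 1 = k.*2.+1)%N by lia.
  have -> : (2 * k.+1 = k.*2.+2)%N by lia.
  by rewrite hit_jump.
set w := jsq_blocked hK; have wE : jsq_lengths w = (K.-1, K) by exact: jsq_blockedE.
have lenI : injective (@jsq_lengths K).
  move=> x y; case: x y => -[a b] p [] [c d] q [ac bd]; apply: val_inj => /=.
  by congr (_, _); apply: val_inj.
have swE : jsq_lengths (jsq_swap w) = (K, K.-1) by case: wE; rewrite /jsq_lengths /= => ->.
have ww : jsq_swap w != w.
  by rewrite -(inj_eq lenI) wE swE xpair_eqE; lia.
have [_ p1 _] := hpi.
under eq_bigr do rewrite mulrBr mulr1 -wE -swE !(inj_eq lenI) mulrA.
rewrite sumrB p1 -mulr_suml => /subr0_eq p1E; rewrite [RHS]p1E; congr (_ * _).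
(* The two blocked states are distinct and, by symmetry, carry equal mass. *)
rewrite (bigD1 w) //= (bigD1 (jsq_swap w)) //= !eqxx orbT big1 => [|x /andP[xw xs]].
  by rewrite (jsq_invariant_swap hK rho0 hpi) -/w /=; ring.
by rewrite (negbTE xw) (negbTE xs) mulr0.
Qed.

Lemma mulr_geo (R : fieldType) (q : R) n : (1 - q) * geo q n = 1 - q ^+ n.
Proof. by rewrite /geo -[RHS]opprB subrX1 -mulNr opprB. Qed.

Theorem theorem2 (R : realFieldType) (K : nat) (rho : R) (hK : (1 <= K)%N)
    (hrho : 0 < rho) (pi : jsq_state K -> R)
    (hpi : invariant_distribution (jsq_rate rho) pi) :
  2 * pi (jsq_blocked hK) =
    2 * rho ^+ (2 * K - 1) /
      (2 * (\sum_(0 <= k < (2 * K - 1).+1) rho ^+ k)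
       - \sum_(0 <= k < (K - 1).+1) (rho / 2) ^+ k)
  /\
  (rho != 1 -> rho != 2 ->
   2 * pi (jsq_blocked hK) =
     (1 - rho) * (2 - rho) /
       (rho ^- (2 * K - 1) + rho * (1 - rho) * (2 * rho) ^- K
        - rho * (2 - rho))).
Proof.
have r0 := lt0r_neq0 hrho.
have := jsq_blocking_inv hK hrho hpi; set B := 2 * pi _; set D := _ - _ => BD.
(* Nonvanishing of the denominator comes for free from the product being 1. *)
have D0 : D != 0 by apply: contra_eq_neq BD => ->; rewrite mulr0 eq_sym oner_neq0.
have -> : B = D^-1 by rewrite -[LHS](mulfK D0) BD mul1r.
have K1 : ((K - 1).+1 = K)%N by lia.
have K2 : ((2 * K - 1).+1 = (2 * K))%N by lia.
(* Multiplication by the top power of [rho] reverses the order of the geometric sum. *)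
have geoV : rho ^+ (2 * K - 1) * geo rho^-1 (2 * K) = geo rho (2 * K).
  rewrite /geo mulr_sumr [RHS](reindex_inj rev_ord_inj) /=; apply: eq_bigr => j _.
  rewrite exprVn -expfB_cond ?(negbTE r0) //; last by have := ltn_ord j; lia.
  by congr (_ ^+ _); lia.
split.
  rewrite K1 K2 !big_mkord -/(geo rho _).
  set S := \sum_(j < K) _.
  have -> : 2 * geo rho (2 * K) - S = 2 * rho ^+ (2 * K - 1) * D.
    by rewrite /D -geoV exprVn -/S; field; rewrite expf_neq0.
  by rewrite invfM mulrA divff ?mul1r // mulf_neq0 ?pnatr_eq0 ?expf_neq0.
move=> r1 r2.
(* This power produces the middle term of the second denominator. *)
have QE : rho^-1 ^+ (2 * K - 1) * (rho / 2) ^+ K = rho * (2 * rho) ^- K.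
  rewrite -exprVn invfM !exprMn mulrA mulrC [RHS]mulrCA; congr (_ * _).
  have -> : (2 * K - 1 = K + K.-1)%N by lia.
  rewrite exprD mulrAC -exprMn mulVf // expr1n mul1r.
  by rewrite -{2}(prednK hK) exprS mulrA mulfV ?mul1r.
have -> : rho ^- (2 * K - 1) + rho * (1 - rho) * (2 * rho) ^- K - rho * (2 - rho)
    = (1 - rho) * (2 - rho) * D.
  have GE := mulr_geo rho^-1 (2 * K); have SE := mulr_geo (rho / 2) K.
  rewrite mulrAC -QE /D -exprVn.
  rewrite -[in RHS]/(geo _ K).
  rewrite -[X in _ = 1 - _ ^+ X]K2 exprS in GE.
  (* Writing [1 - rho] as [- rho * (1 - rho^-1)] and [2 - rho] as [2 * (1 - rho / 2)] puts next to
     each geometric sum the factor that telescopes it. *)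
  have -> : (1 - rho) * (2 - rho) * (geo rho^-1 (2 * K)
      - rho^-1 ^+ (2 * K - 1) / 2 * geo (rho / 2) K) =
    - rho * (2 - rho) * ((1 - rho^-1) * geo rho^-1 (2 * K))
    - (1 - rho) * rho^-1 ^+ (2 * K - 1) * ((1 - rho / 2) * geo (rho / 2) K).
    by field; rewrite r0.
  by rewrite GE SE; field; rewrite r0.
have c0 : (1 - rho) * (2 - rho) != 0.
  by rewrite mulf_neq0 // subr_eq0 eq_sym.
by rewrite invfM mulrA divff ?mul1r.
Qed.
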